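(* Let $\mathcal{H}$ be a real Hilbert space, let $A\colon\mathcal{H}\rightrightarrows\mathcal{H}$ be maximally monotone and strongly monotone with modulus $\gamma_A\ge 0$, and let $B\colon\mathcal{H}\to\mathcal{H}$ be single-valued, $\beta$-co-coercive with $\beta>0$, and strongly monotone with modulus $\gamma_B\geq 0$ (the values $\gamma_A=0$, $\gamma_B=0$ are allowed). Suppose $\mathrm{zer}(A+B)\ne\emptyset$. Let $\sigma\in(0,+\infty)$ and let $(M_k)_{k\in\mathbb{N}}$ be a sequence in $\mathcal{S}_\sigma(\mathcal{H})$ such that, for some $c>0$, $M_k-\frac1\beta\mathrm{Id}\in\mathcal{S}_c(\mathcal{H})$ for all $k\in\mathbb{N}$, and $C:=\sup_{k\in\mathbb{N}}\|M_k\|<\infty$. Let $(\epsilon_k)_{k\in\mathbb{N}}$ be a sequence in $\mathcal{H}$ with $\sum_{k\in\mathbb{N}}\|\epsilon_k\|<+\infty$. Let $z_0\in\mathcal{H}$ and let $(z_k)_{k\in\mathbb{N}}$ be generated, for $k=0,1,2,\dots$, by $$\tilde z_k=J_A^{M_k}\big(z_k-M_k^{-1}Bz_k\big)+\epsilon_k,\qquad v_k=M_k(z_k-\tilde z_k)-(Bz_k-B\tilde z_k),$$ $$t_k=\frac{\langle z_k-\tilde z_k,v_k\rangle}{2\|v_k\|^2},\qquad z_{k+1}=z_k-t_kv_k,$$ where it is assumed that $\tilde z_k\neq z_k$ for all $k\in\mathbb{N}$. Then $(\|z_k-z^*\|)_{k\in\mathbb{N}}$ is bounded for any $z^*\in\mathrm{zer}(A+B)$,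 and $(z_k)_{k\in\mathbb{N}}$ converges weakly to some $z^*\in\mathrm{zer}(A+B)$. Moreover, if $\epsilon_k=0$ for all $k$, then for any $z^*\in\mathrm{zer}(A+B)$ the sequence $(\|z_k-z^*\|)_{k\in\mathbb{N}}$ is decreasing. Furthermore (still with $\epsilon_k= 0$ for all $k$), if $\gamma_A>0$ or $\gamma_B>0$, then $z_k$ converges linearly: there exists $\xi\in(0,1)$ such that, for all $k\in\mathbb{N}$, with $z^*\in\mathrm{zer}(A+B)$, $$\|z_k-z^*\|^2\le(1-\xi)^k\|z_0-z^*\|^2 .$$
   Context: $\mathcal{S}(\mathcal{H})$ is the set of bounded self-adjoint linear operators on $\mathcal{H}$; $U\succeq V$ means $\langle Ux,x\rangle\ge\langle Vx,x\rangle$ for all $x\in\mathcal{H}$; for $\sigma\ge0$, $\mathcal{S}_\sigma(\mathcal{H})=\{U\in\mathcal{S}(\mathcal{H}): U\succeq\sigma\,\mathrm{Id}\}$. $\|M\|$ is the operator norm. $\mathrm{zer}(A+B)=\{x: 0\in Ax+Bx\}$. An operator $A$ is strongly monotone with modulus $\gamma\ge0$ if $\langle x-y,u-v\rangle\ge\gamma\|x-y\|^2$ for all $u\in Ax$, $v\in Ay$ ($\gamma=0$ is ordinary monotonicity). $B$ is $\beta$-co-coercive if $\langle x-y,Bx-By\rangle\ge\beta\|Bx-By\|^2$ for all $x,y$. The resolvent of $A$ in the metric $M$ is $J_A^M=(\mathrm{Id}+M^{-1}A)^{-1}$. *)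

(* Defs.v *)
From HB Require Import structures.
From mathcomp Require Import all_boot all_order all_algebra.
From mathcomp Require Import all_classical all_reals all_analysis.

Set Implicit Arguments.
Unset Strict Implicit.
Unset Printing Implicit Defensive.

Import Order.TTheory GRing.Theory Num.Theory.
Import numFieldNormedType.Exports.

Local Open Scope classical_set_scope.
Local Open Scope ring_scope.

(* A real Hilbert space is a complete normed space H together with a dot      *)
(* product ip inducing its norm.                                              *)
Definition induces_norm (R : realType) (H : normedModType R)
    (ip : {dot H for @idfun R}) : Prop :=
  forall x : H, ip x x = `|x| ^+ 2.

Section SetValuedOperators.
Context (R : realType) (H : normedModType R).
Implicit Types (A B T : H -> set H) (M : H -> H).

Definition op_of (f : H -> H) : H -> set H := fun x => [set f x].

Definition op_add A B : H -> set H :=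
  fun x => [set u + v | u in A x & v in B x].

Definition op_inv T : H -> set H := fun y => [set x | T x y].

Definition zer T : set H := [set x | T x 0].

(* Total inverse of a map, with value 0 outside of its range; it is the       *)
(* two-sided inverse whenever M is bijective.                                 *)
Definition inv_map M : H -> H := 'pinv_(fun=> 0) setT M.

(* J_A^M = (Id + M^-1 A)^-1 as a set-valued operator:                         *)
(* resolvent A M x p means p \in J_A^M x.                                     *)
Definition resolvent A M : H -> set H :=
  op_inv (op_add (op_of idfun) (fun x => inv_map M @` A x)).

End SetValuedOperators.

Section InnerProduct.
Context (R : realType) (H : normedModType R) (ip : {dot H for @idfun R}).
Implicit Types (A : H -> set H) (B U V : H -> H).

Definition strongly_monotone (gamma : R) A : Prop :=
  forall x y u v, A x u -> A y v ->
    gamma * `|x - y| ^+ 2 <= ip (x - y) (u - v).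

Definition monotone_op A : Prop := strongly_monotone 0 A.

Definition maximally_monotone A : Prop :=
  monotone_op A /\
  forall A', monotone_op A' -> (forall x, A x `<=` A' x) ->
    forall x, A' x `<=` A x.

Definition cocoercive (beta : R) B : Prop :=
  forall x y, beta * `|B x - B y| ^+ 2 <= ip (x - y) (B x - B y).

Definition op_ge U V : Prop := forall x, ip (V x) x <= ip (U x) x.

Definition self_adjoint_ops : set (H -> H) :=
  [set U | [/\ linear U, bounded_fun_norm U
             & forall x y, ip (U x) y = ip x (U y)]].

Definition self_adjoint_ops_ge (sigma : R) : set (H -> H) :=
  [set U | self_adjoint_ops U /\ op_ge U (fun x => sigma *: x)].

Definition weakly_cvg_to (u : nat -> H) (l : H) : Prop :=
  forall y, ip (u n) y @[n --> \oo] --> ip l y.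

End InnerProduct.

Definition op_norm (R : realType) (H : normedModType R) (U : H -> H) : R :=
  sup [set `|U x| | x in [set x | `|x| <= 1]].

(* Main.v *)
Require Import Defs.
From HB Require Import structures.
From mathcomp Require Import all_boot all_order all_algebra.
From mathcomp Require Import all_classical all_reals all_analysis.
From mathcomp Require Import ssrAC ring lra.

Set Implicit Arguments.
Unset Strict Implicit.
Unset Printing Implicit Defensive.

Import Order.TTheory GRing.Theory Num.Theory.
Import numFieldNormedType.Exports.

Local Open Scope classical_set_scope.
Local Open Scope ring_scope.

(* Write d_k = z_k - zt_k, p_k = zt_k - eps_k and w_k = M_k (z_k - p_k) -
   (B z_k - B p_k), so that w_k belongs to (A + B) p_k.  Coercivity of
   M_k - beta^-1 Id gives <d_k, v_k> >= c |d_k|^2, hence t_k stays between two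
   positive constants, and monotonicity of A + B turns the relaxed step into
     |z_{k+1} - z*|^2 <= |z_k - z*|^2 - kap |d_k|^2
                         + O(|eps_k| |z_k - z*| + |eps_k|^2),
   which implies |z_{k+1} - z*| <= |z_k - z*| + K |eps_k| and d_k -> 0.  For
   exact resolvents the error term is absent, and strong monotonicity
   contributes a multiple of |zt_k - z*|^2 that makes the rate linear.  At a
   weak cluster point, w_k -> 0 and co-coercivity force B p_k -> B z*
   strongly, so maximality of A shows that the cluster point is a zero of
   A + B; Opial's argument then gives weak convergence.  Cluster points are
   taken along ultrafilters on the indices, so that no diagonal extraction is
   needed and H may be non-separable. *)

(** * Squeeze arguments along a filter *)

Lemma cvg_dist_le (R : realType) (T : Type) (F : set_system T) {FF : Filter F}
    (f g : T -> R) (l : R) :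
  (forall k, `|f k - l| <= g k) -> g @ F --> (0 : R) -> f @ F --> l.
Proof.
move=> fg g0; apply: cvg_sub0 (cvg_cst l); apply: norm_cvg0.
apply: (squeeze_cvgr _ (cvg_cst 0) g0).
by apply: nearW => k; rewrite normr_ge0 fg.
Qed.

Lemma cvg_sqr0 (R : realType) (T : Type) (F : set_system T) {FF : Filter F}
    (f : T -> R) : (forall k, 0 <= f k) ->
  f k ^+ 2 @[k --> F] --> (0 : R) -> f @ F --> (0 : R).
Proof.
move=> f0 ff0; have -> : f = (fun k => Num.sqrt (f k ^+ 2)).
  by apply/funext => k; rewrite sqrtr_sqr ger0_norm.
by rewrite -(sqrtr0 R); apply: continuous_cvg ff0; exact: sqrt_continuous.
Qed.

(** * Inner product calculus and limits of pairings *)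

Section InnerProductTheory.
Context (R : realType) (H : normedModType R) (ip : {dot H for @idfun R}).
Hypothesis ip_norm : induces_norm ip.
Implicit Types (x y z : H).

Lemma ipC x y : ip x y = ip y x.
Proof. by rewrite hermC expr0 mul1r. Qed.

Lemma ipZl a x y : ip (a *: x) y = a * ip x y.
Proof. exact: linearZl_LR. Qed.

Lemma ipZr a x y : ip x (a *: y) = a * ip x y.
Proof. exact: (@linearZr_LR _ _ _ _ _ _ ip). Qed.

Lemma ipDl x y z : ip (x + y) z = ip x z + ip y z.
Proof. exact: linearDl. Qed.

Lemma ipDr x y z : ip x (y + z) = ip x y + ip x z.
Proof. exact: linearDr. Qed.

Lemma ipNl x y : ip (- x) y = - ip x y.
Proof. exact: linearNl. Qed.

Lemma ipNr x y : ip x (- y) = - ip x y.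
Proof. exact: linearNr. Qed.

Lemma ip0l x : ip 0 x = 0.
Proof. exact: linear0l. Qed.

Lemma ip0r x : ip x 0 = 0.
Proof. exact: (linear0r ip). Qed.

Definition ipE := (ipDl, ipNl, ipDr, ipNr, ipZl, ipZr).

Lemma sqnormB x y : `|x - y| ^+ 2 = `|x| ^+ 2 - 2 * ip x y + `|y| ^+ 2.
Proof. rewrite -!ip_norm !ipE. rewrite (ipC y x); ring. Qed.

Lemma ip_le_norm x y : ip x y <= `|x| * `|y|.
Proof.
have [->|x0] := eqVneq x 0; first by rewrite ip0l normr0 mul0r.
have [->|y0] := eqVneq y 0; first by rewrite ip0r normr0 mulr0.
have xy : 0 < `|x| * `|y| by rewrite mulr_gt0 ?normr_gt0.
(* This square expands to twice [|x| |y| (|x| |y| - ip x y)], and the positive factor cancels. *)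
have := sqr_ge0 `|(`|y| *: x) - (`|x| *: y)|.
rewrite sqnormB ipZl ipZr !normrZ !normr_id => h.
have : 0 <= (`|x| * `|y|) * (`|x| * `|y| - ip x y) by lra.
by rewrite pmulr_rge0// subr_ge0.
Qed.

Lemma cauchy_schwarz x y : `|ip x y| <= `|x| * `|y|.
Proof.
rewrite ler_norml ip_le_norm andbT lerNl -ipNl.
by rewrite (le_trans (ip_le_norm _ _))// normrN.
Qed.

Lemma ip_ge_norm x y : - (`|x| * `|y|) <= ip x y.
Proof. by have := cauchy_schwarz x y; rewrite ler_norml => /andP[]. Qed.

Lemma cvg_ipl (T : Type) (F : set_system T) {FF : Filter F} (u : T -> H)
    x y :
  `|u k - x| @[k --> F] --> (0 : R) -> ip (u k) y @[k --> F] --> ip x y.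
Proof.
move=> ux; apply: (@cvg_dist_le _ _ _ _ _ (fun k => `|u k - x| * `|y|)).
  by move=> k; rewrite -ipNl -ipDl cauchy_schwarz.
by rewrite -(mul0r `|y|); apply: cvgMr_tmp.
Qed.

(** Splitting [w k] as [y + (w k - y)] leaves the weak limit tested at [y] and a remainder of size
    at most [K |w k - y|]. *)
Lemma cvg_ip (T : Type) (F : set_system T) {FF : Filter F}
    (u w : T -> H) (x y : H) (K : R) :
  (forall k, `|u k| <= K) ->
  (forall h, ip (u k) h @[k --> F] --> ip x h) ->
  `|w k - y| @[k --> F] --> (0 : R) -> ip (u k) (w k) @[k --> F] --> ip x y.
Proof.
move=> uK ux wy.
have -> : (fun k => ip (u k) (w k)) =
    (fun k => ip (u k) y + ip (u k) (w k - y)).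
  by apply/funext => k; rewrite !ipE addrC subrK.
rewrite -[ip x y]addr0; apply: cvgD; first exact: ux.
apply: (@cvg_dist_le _ _ _ _ _ (fun k => K * `|w k - y|)).
  by move=> k; rewrite subr0 (le_trans (cauchy_schwarz _ _))// ler_wpM2r.
by rewrite -(mulr0 K); apply: cvgMl_tmp.
Qed.

End InnerProductTheory.

(** * Coercive symmetric equations and Riesz representation *)

Lemma quadratic_ge0_linear_eq0 (R : realFieldType) (g q : R) : 0 <= q ->
  (forall h, 0 <= 2 * h * g + h ^+ 2 * q) -> g = 0.
Proof.
move=> q0 hg; have q1 : 0 < q + 1 by lra.
(* The shift [q + 1] keeps the denominator positive when [q = 0]; at this [h] the expression equals
   [- h^2 (q + 2)], negative unless [h = 0]. *)
have := hg (- g / (q + 1)).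
have gE : g = - (- g / (q + 1) * (q + 1)) by rewrite divfK ?opprK// gt_eqF.
move: (- g / (q + 1)) gE => h ->.
have [->|hN0] := eqVneq h 0; first by rewrite mul0r oppr0.
have h2 : 0 < h ^+ 2 by rewrite exprn_even_gt0.
move=> h0; have : 0 <= h ^+ 2 * (- (q + 2)) by lra.
by rewrite pmulr_rge0//; lra.
Qed.

Section LaxMilgram.
Context (R : realType) (H : completeNormedModType R)
  (ip : {dot H for @idfun R}).
Hypothesis ip_norm : induces_norm ip.

(* A minimising sequence of the energy [ip (U x) x - 2 * f x] is Cauchy by the
   parallelogram identity, and its Euler equation passes to the limit because
   [U] is symmetric. *)
Lemma symmetric_lax_milgram (U : {linear H -> H}) (f : {linear H -> R^o})
    (s K : R) : 0 < s ->
  (forall x, s * `|x| ^+ 2 <= ip (U x) x) ->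
  (forall x y, ip (U x) y = ip x (U y)) ->
  (forall x, f x <= K * `|x|) ->
  exists x, forall y, ip (U x) y = f y.
Proof.
move=> s0 coer sym fK.
pose J x : R := ip (U x) x - 2 * f x.
have JD (x y : H) (h : R) :
    J (x + h *: y) = J x + 2 * h * (ip (U x) y - f y) + h ^+ 2 * ip (U y) y.
  have fE : f (x + h *: y) = f x + h * f y by rewrite linearD linearZ.
  have UE : U (x + h *: y) = U x + h *: U y by rewrite linearD linearZ.
  by rewrite /J fE UE !ipE (sym y x) (ipC ip y (U x)); ring.
(* Completing the square in [n = |x|]: [s n^2 - 2 K n >= - K^2 / s]. *)
have Jlb : has_lbound (range J).
  exists (- (K ^+ 2 / s)) => _ [x _ <-]; rewrite /J.
  have := coer x; have := fK x; set n := `|x|.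
  have : 0 <= s * (n - K / s) ^+ 2 by rewrite mulr_ge0 ?sqr_ge0 ?ltW.
  have -> : s * (n - K / s) ^+ 2 = s * n ^+ 2 - 2 * (K * n) + K ^+ 2 / s.
    by field; rewrite gt_eqF.
  lra.
have Jinf : has_inf (range J) by split => //; exists (J 0), 0.
set m := inf (range J).
have mJ x : m <= J x by apply: ge_inf => //; exists x.
have ex_min (n : nat) : exists x, J x < m + n.+1%:R^-1.
  have n0 : 0 < n.+1%:R^-1 :> R by rewrite invr_gt0.
  by have [_ [x _ <-] xm] := inf_adherent n0 Jinf; exists x.
have [u uJ] := choice ex_min.
have u_dist k l (e : R) : J (u k) < m + e -> J (u l) < m + e ->
    s * `|u k - u l| ^+ 2 <= 4 * e.
  move=> ke le; apply: le_trans (coer _) _.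
  have := mJ (u l + 2^-1 *: (u k - u l)); rewrite JD.
  have : J (u k) = J (u l + 1 *: (u k - u l)) by rewrite scale1r addrC subrK.
  rewrite JD; lra.
have /cauchy_cvgP/cvg_ex[x ux] : cauchy (u @ \oo).
  apply/cauchyP => e e0.
  (* With this tolerance [u_dist] gives [s e^2 / 2], strictly below [s e^2]. *)
  have d0 : 0 < s * e ^+ 2 / 8 by rewrite divr_gt0 ?mulr_gt0 ?exprn_gt0.
  have [n _ nP] := near_infty_natSinv_lt (PosNum d0).
  exists (u n); change (\forall k \near \oo, ball (u n) e (u k)); near=> k.
  rewrite -ball_normE/= -(@ltr_pXn2r _ 2)// ?nnegrE ?normr_ge0 ?(ltW e0)//.
  rewrite -(ltr_pM2l s0).
  apply: le_lt_trans (u_dist _ _ (s * e ^+ 2 / 8) _ _) _.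
  - by rewrite (lt_trans (uJ _))// ltrD2l; apply: nP => /=.
  - rewrite (lt_trans (uJ _))// ltrD2l; apply: nP => /=.
    by near: k; exact: nbhs_infty_ge.
  - have : 0 < s * e ^+ 2 by rewrite mulr_gt0 ?exprn_gt0.
    lra.
exists x => y; apply/eqP; rewrite -subr_eq0; apply/eqP.
apply: (@quadratic_ge0_linear_eq0 _ _ (ip (U y) y)).
  by apply: le_trans (coer y); rewrite mulr_ge0 ?sqr_ge0 ?ltW.
move=> h.
have ux0 : `|u k - x| @[k --> \oo] --> (0 : R).
  apply/norm_cvg0P; rewrite -(subrr x); apply: cvgB => //; exact: cvg_cst.
have Uy := cvg_ipl ip_norm (y := U y) ux0.
(* Comparing [J (u k + h *: y) >= m] with [J (u k) < m + 1/(k+1)] gives this bound up to [1/(k+1)];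
   symmetry moves [U] onto [y], so convergence of [u] suffices. *)
have : 0 + 2 * h * (ip x (U y) - f y) + h ^+ 2 * ip (U y) y >= 0.
  have : (fun k => k.+1%:R^-1 + 2 * h * (ip (u k) (U y) - f y)
      + h ^+ 2 * ip (U y) y) @ \oo -->
      0 + 2 * h * (ip x (U y) - f y) + h ^+ 2 * ip (U y) y.
    apply: cvgD; last exact: cvg_cst.
    apply: cvgD; first exact: cvg_harmonic.
    by apply: cvgMl_tmp; apply: cvgD; [exact: Uy|exact: cvg_cst].
  move=> lim; apply: (ler_cvg_to (f := fun=> 0) _ lim); first exact: cvg_cst.
  apply: nearW => k; have := mJ (u k + h *: y); rewrite JD sym.
  have := uJ k; move: (J _) (2 * h * _) (_ ^+ 2 * _) (_^-1) => a b d r.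
  by lra.
by rewrite add0r -sym.
Unshelve. all: by end_near. Qed.

Lemma riesz_representation (f : {linear H -> R^o}) (K : R) :
  (forall x, f x <= K * `|x|) -> exists x, forall y, ip x y = f y.
Proof.
apply: (@symmetric_lax_milgram idfun f 1) => // x.
by rewrite mul1r ip_norm.
Qed.

(** Coercivity kills the kernel, and Lax-Milgram applied to [ip y] reaches every [y]. This makes
    [inv_map] a true inverse of each metric. *)
Lemma self_adjoint_bij (U : {linear H -> H}) (s : R) : 0 < s ->
  (forall x, s * `|x| ^+ 2 <= ip (U x) x) ->
  (forall x y, ip (U x) y = ip x (U y)) -> set_bij setT setT U.
Proof.
move=> s0 coer sym; split => // [x y _ _ xy|y _].
  have := coer (x - y); have -> : U (x - y) = 0.
    by rewrite linearB; apply/eqP; rewrite subr_eq0; apply/eqP.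
  rewrite ip0l pmulr_rle0//.
  by rewrite le_eqVlt ltNge sqr_ge0 orbF sqrf_eq0 normr_eq0 subr_eq0 => /eqP.
pose f : {linear H -> R^o} := ip y.
have [x xP] := @symmetric_lax_milgram U f s `|y| s0 coer sym
  (fun x => ip_le_norm ip_norm y x).
exists x => //; apply/eqP; rewrite -subr_eq0 -normr_eq0 -sqrf_eq0 -ip_norm.
by rewrite ipDl ipNl xP subrr.
Qed.

End LaxMilgram.

(** * Ultrafilter limits and weak compactness *)

Lemma ultra_bounded_cvg (R : realType) (T : Type) (F : set_system T)
    (f : T -> R) (K : R) :
  UltraFilter F -> (forall t, `|f t| <= K) -> exists l : R, f @ F --> l.
Proof.
move=> FU fK.
have [|l [_ Fl]] := @segment_compact R (- K) K (f @ F).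
  by apply: (@filterE _ F) => t /=; rewrite in_itv/= -ler_norml.
(* A cluster point of an ultrafilter is its limit: otherwise the complement of a neighbourhood would
   belong to it. *)
exists l => N Nl; have [//|FNC] := in_ultra_setVsetC (f @^-1` N) FU.
by have [r [NCr Nr]] := Fl (~` N) N FNC Nl.
Qed.

(** If the preimage of a neighbourhood were missing from [F], then [F] restricted to its complement
    would be proper, and an ultrafilter above it would contain both the preimage and the
    complement. *)
Lemma cvg_ultra (T : Type) (S : topologicalType) (F : set_system T)
    (f : T -> S) (l : S) : Filter F ->
  (forall G, UltraFilter G -> F `<=` G -> f @ G --> l) -> f @ F --> l.
Proof.
move=> FF ultra N Nl; apply: contrapT => FN.
have WF : ProperFilter (within (~` (f @^-1` N)) F).
  split; last exact: within_filter.
  move=> W0; apply: FN; change (F (f @^-1` N)).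
  have {}W0 : F [set t | ~ ~ N (f t)] := W0.
  by apply: filterS W0 => t /= /contrapT.
have [G [GU WG]] := ultraFilterLemma WF.
have GF : F `<=` G.
  by move=> A FA; apply: WG; apply: filterS FA => t ? _.
have GN : G (f @^-1` N) by exact: ultra GU GF _ Nl.
have GNC : G (~` (f @^-1` N)) by apply: WG; exact: withinT.
by have [t [Nt]] := filter_ex (filterI GN GNC); apply.
Qed.

Section WeakCompactness.
Context (R : realType) (H : completeNormedModType R)
  (ip : {dot H for @idfun R}).
Hypothesis ip_norm : induces_norm ip.

(** Each bounded real sequence [ip (u k) y] converges along the ultrafilter; the limit is linear in
    [y] and at most [K |y|], so Riesz represents it by a vector. *)
Lemma ultra_weak_cvg (F : set_system nat) (u : nat -> H) (K : R) :
  UltraFilter F -> (forall k, `|u k| <= K) ->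
  exists x, forall y, ip (u k) y @[k --> F] --> ip x y.
Proof.
move=> FU uK.
have /choice[f fP] (y : H) : exists l : R, ip (u k) y @[k --> F] --> l.
  apply: (@ultra_bounded_cvg _ _ _ _ (K * `|y|)) => k.
  by rewrite (le_trans (cauchy_schwarz ip_norm _ _))// ler_wpM2r.
have flin : linear (f : H -> R^o).
  move=> a x y; apply: (cvg_unique _ (fP (a *: x + y))) => //.
  have -> : (fun k => ip (u k) (a *: x + y)) =
      (fun k => a * ip (u k) x + ip (u k) y).
    by apply/funext => k; rewrite !ipE.
  by apply: cvgD => //; apply: cvgMl_tmp.
pose L : {linear H -> R^o} := HB.pack (f : H -> R^o)
  (GRing.isLinear.Build _ _ _ _ (f : H -> R^o) flin).
have [y|x xP] := @riesz_representation _ _ ip ip_norm L K.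
  apply: (ler_cvg_to (fP y) (cvg_cst (K * `|y|))); apply: nearW => k.
  by rewrite (le_trans (ip_le_norm ip_norm _ _))// ler_wpM2r.
by exists x => y; rewrite xP; exact: fP.
Qed.

End WeakCompactness.

(** * Quasi-Fejer monotone real sequences *)

Section QuasiFejer.
Context (R : realType).
Implicit Types (D e : nat -> R).

(** Subtracting [K] times the partial sums of [e] from [D] leaves a nonincreasing sequence, bounded
    below because the series converges. *)
Lemma quasi_fejer_cvg D e (K : R) :
  (forall k, 0 <= D k) -> (forall k, 0 <= e k) -> 0 <= K ->
  cvgn (series e) -> (forall k, D k.+1 <= D k + K * e k) -> cvgn D.
Proof.
move=> D0 e0 K0 ecvg DS.
have eS : nondecreasing_seq (series e) by apply: nondecreasing_series.
have uP n : D n.+1 - K * series e n.+1 <= D n - K * series e n.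
  by rewrite seriesSr; have := DS n; lra.
have ucvg : cvgn (fun n => D n - K * series e n).
  apply: nonincreasing_is_cvgn; first by apply/nonincreasing_seqP.
  exists (- (K * limn (series e))) => _ [n _ <-].
  have := ler_wpM2l K0 (nondecreasing_cvgn_le eS ecvg n).
  by have := D0 n; lra.
have -> : D = (fun n => D n - K * series e n) + (fun n => K * series e n).
  by apply/funext => n; rewrite fctE subrK.
by apply: is_cvgD => //; apply: is_cvgMl_tmp.
Qed.

End QuasiFejer.

Lemma cvgn_bounded (R : realType) (V : normedModType R) (u : nat -> V) :
  cvgn u -> exists K, forall k, `|u k| <= K.
Proof.
move=> /cvg_seq_bounded/pinfty_ex_gt0[K _ uK].
by exists K => k; exact: uK.
Qed.

(** * Opial's lemma along ultrafilters *)

Section Opial.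
Context (R : realType) (H : completeNormedModType R)
  (ip : {dot H for @idfun R}).
Hypothesis ip_norm : induces_norm ip.

(** For two weak cluster points [x0], [x] in [S], the difference of the squared distances to [u k]
    converges, hence so does [ip (u k) (x0 - x)]. Evaluating its limit along both ultrafilters gives
    [ip x0 (x0 - x) = ip x (x0 - x)], that is [x0 = x]. *)
Lemma opial (S : set H) (u : nat -> H) : S !=set0 ->
  (forall x, S x -> cvgn (fun k => `|u k - x|)) ->
  (forall F x, UltraFilter F -> \oo `<=` F ->
    (forall y, ip (u k) y @[k --> F] --> ip x y) -> S x) ->
  exists2 x, S x & weakly_cvg_to ip u x.
Proof.
move=> [s Ss] ucvg clusterS.
have [K uK] : exists K, forall k, `|u k| <= K.
  have [K uK] := cvgn_bounded (ucvg _ Ss); exists (K + `|s|) => k.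
  rewrite -[u k](subrK s) (le_trans (ler_normD _ _))// lerD2r.
  by have := uK k; rewrite normr_id.
have ex_cluster F : UltraFilter F -> \oo `<=` F ->
    exists2 x, S x & forall y, ip (u k) y @[k --> F] --> ip x y.
  move=> FU oF; have [x ux] := ultra_weak_cvg ip_norm FU uK.
  by exists x => //; exact: clusterS ux.
have [F0 [F0U oF0]] := ultraFilterLemma eventually_filter.
have [x0 Sx0 ux0] := ex_cluster _ F0U oF0.
exists x0 => // y; apply: cvg_ultra => G GU oG.
have [x Sx ux] := ex_cluster _ GU oG.
suff -> : x0 = x by exact: ux.
have [m um] : exists m : R, ip (u k) (x0 - x) @[k --> \oo] --> m.
  have /cvg_ex[a ua] := ucvg _ Sx; have /cvg_ex[b ub] := ucvg _ Sx0.
  exists ((a ^+ 2 - b ^+ 2 - `|x| ^+ 2 + `|x0| ^+ 2) / 2).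
  have -> : (fun k => ip (u k) (x0 - x)) = (fun k =>
      (`|u k - x| ^+ 2 - `|u k - x0| ^+ 2 - `|x| ^+ 2 + `|x0| ^+ 2) / 2).
    by apply/funext => k; rewrite !(sqnormB ip_norm) !ipE; field.
  apply: cvgMr_tmp; apply: cvgD; last exact: cvg_cst.
  apply: cvgD; last exact: cvg_cst.
  by apply: cvgB; rewrite expr2; apply: cvgM.
have m0 : ip x0 (x0 - x) = m.
  by apply: (cvg_unique _ (ux0 _)) => //; exact: cvg_trans (cvg_app _ oF0) um.
have m1 : ip x (x0 - x) = m.
  by apply: (cvg_unique _ (ux _)) => //; exact: cvg_trans (cvg_app _ oG) um.
apply/eqP; rewrite -subr_eq0 -normr_eq0 -sqrf_eq0 -ip_norm ipDl ipNl m0 m1.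
by rewrite subrr.
Qed.

End Opial.

(** * Monotone operators and weak limits *)

Section MonotoneOperators.
Context (R : realType) (H : normedModType R) (ip : {dot H for @idfun R}).
Hypothesis ip_norm : induces_norm ip.
Implicit Types (A : H -> set H) (B : H -> H).

Lemma zer_op_addE A B x : zer (op_add A (op_of B)) x <-> A x (- B x).
Proof.
split=> [[u Au [_ -> /eqP]]|ABx]; first by rewrite addr_eq0 => /eqP <-.
by exists (- B x) => //; exists (B x) => //; rewrite addNr.
Qed.

Lemma cocoercive_lipschitz (beta : R) B : 0 < beta -> cocoercive ip beta B ->
  forall x y, `|B x - B y| <= beta^-1 * `|x - y|.
Proof.
move=> b0 coco x y; have [->|BN] := eqVneq (B x - B y) 0.
  by rewrite normr0 mulr_ge0// invr_ge0 ltW.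
have n0 : 0 < `|B x - B y| by rewrite normr_gt0.
rewrite ler_pdivlMl// -(ler_pM2r n0) -mulrA -expr2.
exact: le_trans (coco x y) (ip_le_norm ip_norm _ _).
Qed.

Section Limits.
Context (F : set_system nat) {FF : ProperFilter F}.
Context (p : nat -> H) (x : H) (K : R).
Hypothesis pK : forall k, `|p k| <= K.
Hypothesis px : forall h, ip (p k) h @[k --> F] --> ip x h.

Lemma cvg_ip_sub (a : nat -> H) (b y u : H) :
  `|a k - b| @[k --> F] --> (0 : R) ->
  ip (p k - y) (a k - u) @[k --> F] --> ip (x - y) (b - u).
Proof.
move=> ab; apply: (cvg_ip ip_norm (K := K + `|y|)).
- by move=> k; rewrite (le_trans (ler_normB _ _))// lerD2r.
- move=> h; have -> : (fun k => ip (p k - y) h) =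
      (fun k => ip (p k) h - ip y h).
    by apply/funext => k; rewrite !ipE.
  by rewrite !ipE; apply: cvgD; [exact: px|exact: cvg_cst].
- by under eq_fun do rewrite opprB addrA subrK.
Qed.

(** Monotonicity between [(p k, a k)] and any point of the graph passes to the limit, so adjoining
    [(x, b)] keeps the graph monotone; maximality then puts it in [A]. *)
Lemma maximally_monotone_weak_strong A (a : nat -> H) (b : H) :
  maximally_monotone ip A -> (forall k, A (p k) (a k)) ->
  `|a k - b| @[k --> F] --> (0 : R) -> A x b.
Proof.
move=> [Amono Amax] Apa ab.
have key y u : A y u -> 0 <= ip (x - y) (b - u).
  move=> Ayu; have lim := cvg_ip_sub (y := y) (u := u) ab.
  apply: (ler_cvg_to (f := fun=> 0) _ lim); first exact: cvg_cst.
  by apply: nearW => k; have := Amono _ _ _ _ (Apa k) Ayu; rewrite mul0r.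
apply: (Amax (fun y => A y `|` [set u | y = x /\ u = b])); first last.
- by right.
- by move=> y u; left.
move=> y1 y2 u1 u2 [A1|[-> ->]] [A2|[-> ->]].
- exact: Amono.
- by rewrite mul0r -opprB ipNl -ipNr opprB; exact: key.
- by rewrite mul0r; exact: key.
- by rewrite !subrr ip0l mul0r.
Qed.

Lemma weak_limit_zer A B (beta : R) (w : nat -> H) (zs : H) :
  maximally_monotone ip A -> 0 < beta -> cocoercive ip beta B ->
  zer (op_add A (op_of B)) zs ->
  (forall k, A (p k) (w k - B (p k))) -> `|w k| @[k --> F] --> (0 : R) ->
  zer (op_add A (op_of B)) x.
Proof.
move=> Amax b0 coco /zer_op_addE Azs Apw w0.
(* Co-coercivity and monotonicity of [A] give [beta |B (p k) - B zs|^2 <= ip (p k - zs) (w k)], and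
   [p] is bounded. *)
have Bp0 : `|B (p k) - B zs| @[k --> F] --> (0 : R).
  apply: cvg_sqr0 => [//|].
  apply: (@cvg_dist_le _ _ _ _ _ (fun k => (beta^-1 * (K + `|zs|)) * `|w k|)).
    move=> k; rewrite subr0 ger0_norm ?sqr_ge0// -mulrA ler_pdivlMl//.
    have := Amax.1 _ _ _ _ (Apw k) Azs; rewrite mul0r.
    have -> : w k - B (p k) - - B zs = w k - (B (p k) - B zs).
      by rewrite opprK opprB addrA addrAC.
    rewrite ipDr ipNr subr_ge0 => /(le_trans (coco _ _)) /le_trans; apply.
    apply: le_trans (ip_le_norm ip_norm _ _) _; rewrite ler_wpM2r//.
    by rewrite (le_trans (ler_normB _ _))// lerD2r.
  by rewrite -(mulr0 (beta^-1 * (K + `|zs|))); apply: cvgMl_tmp.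
(* Co-coercivity between [p k] and [x] has limit [beta |B zs - B x|^2 <= ip (x - x) _ = 0]. *)
have BxE : B x = B zs.
  have lim := cvg_ip_sub (y := x) (u := B x) Bp0.
  have : 0 <= ip (x - x) (B zs - B x) - beta * `|B zs - B x| ^+ 2.
    have limN : ip (p k - x) (B (p k) - B x) - beta * `|B (p k) - B x| ^+ 2
        @[k --> F] --> ip (x - x) (B zs - B x) - beta * `|B zs - B x| ^+ 2.
      have BpN : `|B (p k) - B x| @[k --> F] --> `|B zs - B x|.
        apply: (cvg_dist_le _ Bp0) => k.
        by rewrite (le_trans (ler_dist_dist _ _))// opprB addrA subrK.
      by apply: cvgB => //; apply: cvgMl_tmp; rewrite expr2; apply: cvgM.
    apply: (ler_cvg_to (f := fun=> 0) _ limN); first exact: cvg_cst.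
    by apply: nearW => k; rewrite subr_ge0 coco.
  rewrite subrr ip0l sub0r oppr_ge0 pmulr_rle0// => le0.
  apply/eqP; rewrite eq_sym -subr_eq0 -normr_eq0 -sqrf_eq0.
  by rewrite eq_le le0 sqr_ge0.
apply/zer_op_addE; rewrite BxE.
apply: (maximally_monotone_weak_strong Amax Apw).
apply: (@cvg_dist_le _ _ _ _ _ (fun k => `|w k| + `|B (p k) - B zs|)).
  move=> k; rewrite subr0 normr_id.
  have -> : w k - B (p k) - - B zs = w k - (B (p k) - B zs).
    by rewrite opprK opprB addrA addrAC.
  exact: ler_normB.
by rewrite -[0]addr0; apply: cvgD.
Qed.

End Limits.
End MonotoneOperators.

(** * Metrics, resolvents and the forward operator *)

Section Operators.
Context (R : realType) (H : normedModType R) (ip : {dot H for @idfun R}).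
Hypothesis ip_norm : induces_norm ip.
Implicit Types (A : H -> set H) (B M : H -> H).

Lemma op_norm_le M : linear M -> bounded_fun_norm M ->
  forall x, `|M x| <= op_norm M * `|x|.
Proof.
move=> Mlin Mbd x.
pose L : {linear H -> H} := HB.pack M (GRing.isLinear.Build _ _ _ _ M Mlin).
have [->|x0] := eqVneq x 0;
  first by rewrite -[M]/(L : H -> H) linear0 !normr0 mulr0.
have n0 : 0 < `|x| by rewrite normr_gt0.
have -> : M x = `|x| *: M (`|x|^-1 *: x).
  by rewrite -[M]/(L : H -> H) linearZ scalerA divff ?scale1r ?gt_eqF.
rewrite normrZ normr_id mulrC ler_pM2r//; apply: ub_le_sup.
  have [K MK] := Mbd 1; exists K => _ [y y1 <-]; exact: MK.
exists (`|x|^-1 *: x) => //=.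
by rewrite normrZ ger0_norm ?invr_ge0// mulVf// gt_eqF.
Qed.

Lemma linear_fun_sub M : linear M -> forall x y, M (x - y) = M x - M y.
Proof.
move=> Mlin x y.
pose L : {linear H -> H} := HB.pack M (GRing.isLinear.Build _ _ _ _ M Mlin).
exact: (linearB L).
Qed.

(** The resolvent relation reads [p + inv_map M a = z - inv_map M b] with [a] in [A p]; applying [M]
    solves it for [a]. *)
Lemma resolvent_sub A M (z b p : H) : linear M -> set_bij setT setT M ->
  resolvent A M (z - inv_map M b) p -> A p (M (z - p) - b).
Proof.
move=> Mlin [_ _ Msurj] [_ -> [_ [a Aa <-] paz]].
have MK : cancel (inv_map M) M.
  by move=> y; apply: (surjpK _ Msurj); rewrite inE.
suff -> : M (z - p) - b = a by [].
have -> : z - p = inv_map M a - (0 - inv_map M b).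
  rewrite sub0r opprK -[z in LHS](subrK (inv_map M b)) -paz -(addrA p).
  by rewrite [LHS]addrC addKr.
rewrite (linear_fun_sub Mlin (inv_map M a)) (linear_fun_sub Mlin 0) !MK.
have -> : M 0 = 0 by have := linear_fun_sub Mlin 0 0; rewrite !subrr.
by rewrite sub0r opprK addrK.
Qed.

(** [B] is Lipschitz with constant [beta^-1], so the [beta^-1] part of [M] absorbs
    [ip (x - y) (B x - B y)] and [c] remains. *)
Lemma forward_coercive M B (beta c : R) : 0 < beta -> cocoercive ip beta B ->
  op_ge ip (fun x => M x - beta^-1 *: x) (fun x => c *: x) ->
  forall x y, c * `|x - y| ^+ 2 <= ip (x - y) (M (x - y) - (B x - B y)).
Proof.
move=> b0 coco Mc x y; have := Mc (x - y).
have := cocoercive_lipschitz ip_norm b0 coco x y.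
have := ip_le_norm ip_norm (x - y) (B x - B y).
move: (x - y) (B x - B y) => d g dg gd.
rewrite /= !ipE !ip_norm (ipC ip (M d) d) => h.
have : ip d g <= beta^-1 * `|d| ^+ 2.
  by apply: le_trans dg _; rewrite mulrC expr2 mulrA ler_wpM2r.
lra.
Qed.

Lemma forward_norm_le M B (beta C : R) : 0 < beta -> cocoercive ip beta B ->
  (forall x, `|M x| <= C * `|x|) ->
  forall x y, `|M (x - y) - (B x - B y)| <= (C + beta^-1) * `|x - y|.
Proof.
move=> b0 coco MC x y; rewrite (le_trans (ler_normB _ _))// mulrDl lerD//.
exact: (cocoercive_lipschitz ip_norm b0 coco).
Qed.

(** Strong monotonicity applies to the exact element [w] of [(A + B) p]. Passing from [w] to [v] and
    from [p] to [zt] costs the two error terms, since [w - v] is the forward operator's increment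
    between [zt] and [p]. *)
Lemma inexact_monotone A B M (gammaA gammaB beta C : R) (z p zt zs v : H) :
  strongly_monotone ip gammaA A -> strongly_monotone ip gammaB (op_of B) ->
  0 < beta -> cocoercive ip beta B ->
  linear M -> (forall x, `|M x| <= C * `|x|) ->
  zer (op_add A (op_of B)) zs -> A p (M (z - p) - B z) ->
  v = M (z - zt) - (B z - B zt) ->
  (gammaA + gammaB) * `|p - zs| ^+ 2
    - (C + beta^-1) * `|zt - p| * `|p - zs| - `|zt - p| * `|v| <=
  ip (zt - zs) v.
Proof.
move=> Astr Bstr b0 coco Mlin MC /zer_op_addE Azs Ap vE.
pose w := M (z - p) - B z + B p.
have pw : (gammaA + gammaB) * `|p - zs| ^+ 2 <= ip (p - zs) w.
  have := Astr _ _ _ _ Ap Azs; have := Bstr p zs _ _ erefl erefl.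
  by rewrite /w !ipE; lra.
have wv : w - v = M (zt - p) - (B zt - B p).
  have -> : zt - p = (z - p) - (z - zt) by rewrite opprB [RHS]addrC addrA subrK.
  rewrite (linear_fun_sub Mlin (z - p)) /w vE.
  move: (M (z - p)) (M (z - zt)) (B z) (B p) (B zt) => a1 a2 a3 a4 a5.
  rewrite (opprB a2) (opprB a5) !addrA.
  by rewrite [LHS](ACl (1 * 6 * 3 * 5 * 2 * 4))%AC/= subrK.
have := ip_ge_norm ip_norm (p - zs) (v - w).
have := ip_ge_norm ip_norm (zt - p) v.
have : ip (zt - zs) v = ip (zt - p) v + ip (p - zs) w + ip (p - zs) (v - w).
  by rewrite !ipE; ring.
have := ler_wpM2r (normr_ge0 (p - zs)) (forward_norm_le b0 coco MC zt p).
rewrite -wv (distrC w); lra.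
Qed.

End Operators.

(** * Geometry of one relaxed step *)

Section Step.
Context (R : realType) (H : normedModType R) (ip : {dot H for @idfun R}).
Hypothesis ip_norm : induces_norm ip.

(** Coercivity and Cauchy-Schwarz give [c |d| <= |v| <= L |d|], so [ip d v] and [|v|^2] are
    comparable. *)
Lemma step_size (d v : H) (c L : R) : 0 < c -> 0 < L -> d != 0 ->
  c * `|d| ^+ 2 <= ip d v -> `|v| <= L * `|d| ->
  let t := ip d v / (2 * `|v| ^+ 2) in
  [/\ c / (2 * L ^+ 2) <= t, 2 * t <= c^-1, 2 * t * `|v| ^+ 2 = ip d v
    & c ^+ 2 / (2 * L ^+ 2) * `|d| ^+ 2 <= t * ip d v].
Proof.
move=> c0 L0 dN0 cd vL t.
have d0 : 0 < `|d| by rewrite normr_gt0.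
have dv := ip_le_norm ip_norm d v.
have cdv : c * `|d| <= `|v|.
  by rewrite -(ler_pM2l d0) mulrCA -expr2 (le_trans cd).
have v0 : 0 < `|v| by apply: lt_le_trans cdv; rewrite mulr_gt0.
have vv0 : 0 < `|v| ^+ 2 by rewrite exprn_gt0.
have tv : 2 * t * `|v| ^+ 2 = ip d v.
  by rewrite /t; field; rewrite gt_eqF.
have LL0 : 0 < L ^+ 2 by rewrite exprn_gt0.
have ct : c / (2 * L ^+ 2) <= t.
  rewrite ler_pdivlMr ?mulr_gt0//.
  have -> : c / (2 * L ^+ 2) * (2 * `|v| ^+ 2) = c * `|v| ^+ 2 / L ^+ 2.
    by field; rewrite gt_eqF.
  rewrite ler_pdivrMr//.
  have : `|v| ^+ 2 <= L ^+ 2 * `|d| ^+ 2.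
    by rewrite -exprMn lerXn2r// nnegrE// mulr_ge0// ltW.
  move=> /(ler_wpM2l (ltW c0)); have := ler_wpM2r (ltW LL0) cd; lra.
split => //.
- rewrite -(ler_pM2r vv0) tv ler_pdivlMl//.
  have := ler_wpM2l (ltW c0) dv; have := ler_wpM2r (ltW v0) cdv; lra.
- have : 0 <= c * `|d| ^+ 2 by rewrite mulr_ge0 ?ltW// exprn_gt0.
  have c'0 : 0 <= c / (2 * L ^+ 2) by rewrite divr_ge0 ?mulr_ge0 ?ltW.
  move=> cd0; apply: le_trans (ler_pM c'0 cd0 ct cd).
  by rewrite le_eqVlt; apply/orP; left; apply/eqP; field; rewrite gt_eqF.
Qed.

(** The step rule turns [t^2 |v|^2] into [t / 2 * ip (z - zt) v], and [- 2 + 1 / 2] yields the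
    factor [- 3 / 2]. *)
Lemma relaxed_step_dist (z zt zs v : H) (t : R) :
  2 * t * `|v| ^+ 2 = ip (z - zt) v ->
  `|z - t *: v - zs| ^+ 2 = `|z - zs| ^+ 2 - 3 / 2 * (t * ip (z - zt) v)
                            - 2 * t * ip (zt - zs) v.
Proof.
move=> tv; rewrite (addrAC z) (sqnormB ip_norm (z - zs)) normrZ exprMn.
rewrite real_normK ?num_real// ipZr.
have -> : ip (z - zs) v = ip (z - zt) v + ip (zt - zs) v.
  by rewrite -ipDl addrA subrK.
have -> : t ^+ 2 * `|v| ^+ 2 = t / 2 * ip (z - zt) v by rewrite -tv; field.
by field.
Qed.

End Step.

(** * Scalar estimates for the errors *)

Lemma absorb_errors (R : realFieldType) (k q D D' d e : R) : 0 < k -> 0 <= q ->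
  D' ^+ 2 <= D ^+ 2 - 3 / 2 * (k * d ^+ 2) + q * (e * (D + 2 * d + e)) ->
  D' ^+ 2 <= D ^+ 2 - k * d ^+ 2 + q * e * D + (q + 2 * q ^+ 2 / k) * e ^+ 2.
Proof.
move=> k0 q0 h; apply: le_trans h _.
(* Young's inequality: absorbing [2 q e d] spends [k / 2 * d^2], lowering the factor [3 / 2] to
   [1]. *)
have : 0 <= k / 2 * (d - 2 * q * e / k) ^+ 2.
  by rewrite mulr_ge0 ?sqr_ge0// divr_ge0// ltW.
have -> : k / 2 * (d - 2 * q * e / k) ^+ 2 =
   k / 2 * d ^+ 2 - 2 * q * e * d + 2 * q ^+ 2 / k * e ^+ 2.
  by field; rewrite gt_eqF.
lra.
Qed.

(** The constant [a + b + 1] is large enough that its double exceeds [a] and its square exceeds [b],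
    so the squared right-hand side dominates term by term. *)
Lemma sqr_perturb_le (R : realFieldType) (a b D D' e : R) : 0 <= a -> 0 <= b ->
  0 <= D -> 0 <= D' -> 0 <= e ->
  D' ^+ 2 <= D ^+ 2 + a * e * D + b * e ^+ 2 -> D' <= D + (a + b + 1) * e.
Proof.
move=> a0 b0 D0 D'0 e0 h.
rewrite -(@ler_pXn2r _ 2)// ?nnegrE ?addr_ge0 ?mulr_ge0 ?addr_ge0//.
apply: le_trans h _.
have : 0 <= (a + 2 * b + 2) * (e * D).
  by rewrite mulr_ge0 ?(mulr_ge0 e0 D0)//; lra.
have : 0 <= ((a + b + 1) ^+ 2 - b) * e ^+ 2.
  by rewrite mulr_ge0 ?sqr_ge0//; nra.
lra.
Qed.

Theorem theorem3p4 (R : realType) (H : completeNormedModType R)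
  (ip : {dot H for @idfun R}) (ip_norm : induces_norm ip)
  (A : H -> set H) (B : H -> H) (gammaA gammaB beta : R)
  (gammaA_ge0 : 0 <= gammaA) (gammaB_ge0 : 0 <= gammaB) (beta_gt0 : 0 < beta)
  (A_max : maximally_monotone ip A)
  (A_strong : strongly_monotone ip gammaA A)
  (B_coco : cocoercive ip beta B)
  (B_strong : strongly_monotone ip gammaB (op_of B))
  (zer_neq0 : zer (op_add A (op_of B)) !=set0)
  (sigma c : R) (sigma_gt0 : 0 < sigma) (c_gt0 : 0 < c)
  (M : nat -> H -> H)
  (M_sigma : forall k, self_adjoint_ops_ge ip sigma (M k))
  (M_c : forall k,
     self_adjoint_ops_ge ip c (fun x => M k x - beta^-1 *: x))
  (M_bounded : has_ubound (range (fun k => op_norm (M k))))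
  (eps : nat -> H) (eps_summable : cvgn [normed series eps])
  (z zt v : nat -> H) (t : nat -> R)
  (zt_def : forall k,
     resolvent A (M k) (z k - inv_map (M k) (B (z k))) (zt k - eps k))
  (v_def : forall k, v k = M k (z k - zt k) - (B (z k) - B (zt k)))
  (t_def : forall k, t k = ip (z k - zt k) (v k) / (2 * `|v k| ^+ 2))
  (z_def : forall k, z k.+1 = z k - t k *: v k)
  (zt_neq : forall k, zt k != z k) :
  [/\ forall zs, zer (op_add A (op_of B)) zs ->
        bounded_fun (fun k => `|z k - zs|),
      exists2 zs, zer (op_add A (op_of B)) zs & weakly_cvg_to ip z zs,
      (forall k, eps k = 0) ->
        forall zs, zer (op_add A (op_of B)) zs ->
          decreasing_seq (fun k => `|z k - zs|)
    & (forall k, eps k = 0) -> 0 < gammaA \/ 0 < gammaB ->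
        exists2 xi : R, 0 < xi < 1 &
          forall zs, zer (op_add A (op_of B)) zs ->
            forall k, `|z k - zs| ^+ 2 <= (1 - xi) ^+ k * `|z 0%N - zs| ^+ 2].
Proof.

(* Uniform bounds on the metrics and on [v k] *)
have [C0 C0P] := M_bounded.
pose C := `|C0|.
have Mlin k : linear (M k) by case: (M_sigma k) => -[].
have MC k x : `|M k x| <= C * `|x|.
  have [[_ Mbd _] _] := M_sigma k.
  rewrite (le_trans (op_norm_le (Mlin k) Mbd x))// ler_wpM2r//.
  by rewrite (le_trans _ (ler_norm _))//; apply: C0P; exists k.
have Mbij k : set_bij setT setT (M k).
  have [[_ _ Msym] Mge] := M_sigma k.
  pose U : {linear H -> H} :=
    HB.pack (M k) (GRing.isLinear.Build _ _ _ _ (M k) (Mlin k)).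
  apply: (self_adjoint_bij ip_norm (U := U) sigma_gt0) => // x.
  by rewrite -ip_norm -ipZl; exact: Mge.
pose L := C + beta^-1.
have L0 : 0 < L by rewrite ltr_wpDl ?invr_gt0 /C.
pose d k := z k - zt k; pose p k := zt k - eps k.
have dN0 k : d k != 0 by rewrite subr_eq0 eq_sym.
have Ap k : A (p k) (M k (z k - p k) - B (z k)).
  exact: (resolvent_sub (Mlin k) (Mbij k) (zt_def k)).
have dv k : c * `|d k| ^+ 2 <= ip (d k) (v k).
  by rewrite v_def; apply: (forward_coercive ip_norm beta_gt0 B_coco);
    case: (M_c k).
have vL k : `|v k| <= L * `|d k|
  by rewrite v_def; exact: (forward_norm_le ip_norm beta_gt0 B_coco (MC k)).

(* Descent inequality with errors *)
pose kap := c ^+ 2 / (2 * L ^+ 2).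
have kap0 : 0 < kap by rewrite divr_gt0 ?mulr_gt0 ?exprn_gt0.
have step k : [/\ c / (2 * L ^+ 2) <= t k, 2 * t k <= c^-1,
    2 * t k * `|v k| ^+ 2 = ip (d k) (v k)
    & kap * `|d k| ^+ 2 <= t k * ip (d k) (v k)].
  by rewrite t_def; exact: (step_size ip_norm c_gt0 L0 (dN0 k) (dv k) (vL k)).
have dist k zs : `|z k.+1 - zs| ^+ 2 <= `|z k - zs| ^+ 2
    - 3 / 2 * (kap * `|d k| ^+ 2) - 2 * t k * ip (zt k - zs) (v k).
  have [_ _ tv tk] := step k.
  rewrite z_def (relaxed_step_dist ip_norm _ tv) lerD2r lerD2l lerN2.
  by rewrite ler_wpM2l ?divr_ge0.
have t0 k : 0 < t k.
  by have [ct _ _ _] := step k; apply: lt_le_trans ct;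
    rewrite divr_gt0 ?mulr_gt0 ?exprn_gt0.
have inner k zs : zer (op_add A (op_of B)) zs ->
    (gammaA + gammaB) * `|p k - zs| ^+ 2
      - L * `|eps k| * `|p k - zs| - `|eps k| * `|v k| <= ip (zt k - zs) (v k).
  move=> zsP; have := inexact_monotone ip_norm A_strong B_strong beta_gt0 B_coco
    (Mlin k) (MC k) zsP (Ap k) (v_def k).
  by have -> : zt k - p k = eps k by rewrite /p opprB addrC subrK.
(* The error in [inner] is at most [L * Y], and the step contributes [2 * t k <= c^-1]. *)
pose q := L / c.
have q0 : 0 < q by rewrite divr_gt0.
have inexact k zs : zer (op_add A (op_of B)) zs -> `|z k.+1 - zs| ^+ 2 <=
    `|z k - zs| ^+ 2 - kap * `|d k| ^+ 2 + q * `|eps k| * `|z k - zs|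
    + (q + 2 * q ^+ 2 / kap) * `|eps k| ^+ 2.
  move=> zsP; apply: absorb_errors => //; first exact: ltW.
  apply: le_trans (dist k zs) _; rewrite lerD2l.
  have [_ tc _ _] := step k; have ik := inner k zs zsP.
  (* [Y] is [|eps k| (|z k - zs| + 2 |d k| + |eps k|)]: one [|d k|] comes from [|p k - zs|], the
     other from [|v k| <= L |d k|]. *)
  set Y := `|eps k| * _.
  have Y0 : 0 <= Y by rewrite !mulr_ge0 ?addr_ge0 ?mulr_ge0.
  have XY : - ip (zt k - zs) (v k) <= L * Y.
    have pzs : `|p k - zs| <= `|z k - zs| + `|d k| + `|eps k|.
      have -> : p k - zs = z k - zs - d k - eps k.
        rewrite /p /d (opprB (z k)) !addrA.
        by rewrite [RHS](ACl (1 * 4 * 3 * 5 * 2))%AC/= subrr add0r.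
      by rewrite (le_trans (ler_normB _ _))// lerD2r ler_normB.
    have := ler_wpM2l (normr_ge0 (eps k)) (vL k).
    have := ler_wpM2l (mulr_ge0 (ltW L0) (normr_ge0 (eps k))) pzs.
    have : 0 <= (gammaA + gammaB) * `|p k - zs| ^+ 2.
      by rewrite mulr_ge0 ?addr_ge0 ?exprn_ge0.
    rewrite /Y; lra.
  have -> : q * Y = c^-1 * (L * Y) by rewrite /q mulrAC mulrC.
  apply: (@le_trans _ _ (2 * t k * (L * Y))).
    by rewrite -mulrN ler_wpM2l// mulr_ge0 ?ltW.
  by rewrite ler_wpM2r// mulr_ge0// ltW.

(* Convergence of the distances and vanishing residuals *)
pose K := q + (q + 2 * q ^+ 2 / kap) + 1.
have b0 : 0 <= q + 2 * q ^+ 2 / kap.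
  rewrite addr_ge0 ?(ltW q0)// divr_ge0 ?(ltW kap0)// mulr_ge0//.
  by rewrite exprn_ge0// (ltW q0).
have K0 : 0 <= K by rewrite addr_ge0 ?(addr_ge0 (ltW q0) b0).
have fejer zs : zer (op_add A (op_of B)) zs -> cvgn (fun k => `|z k - zs|).
  move=> zsP;
  apply: (quasi_fejer_cvg (e := fun k => `|eps k|) (K := K)) => // k.
  apply: sqr_perturb_le => //; first exact: ltW.
  apply: le_trans (inexact k zs zsP) _; rewrite lerD2r lerD2r gerBl.
  by rewrite mulr_ge0 ?(ltW kap0)// exprn_ge0.
have eps0 : `|eps k| @[k --> \oo] --> (0 : R) by exact: cvg_series_cvg_0.
have d0 : `|d k| @[k --> \oo] --> (0 : R).
  apply: cvg_sqr0 => [//|]; have [zs zsP] := zer_neq0.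
  have /cvg_ex[l zl] := fejer zs zsP.
  (* This is [inexact] solved for [|d k|^2]; consecutive squared distances share the limit [l^2], so
     [g] tends to 0. *)
  pose g k := kap^-1 * (`|z k - zs| ^+ 2 - `|z k.+1 - zs| ^+ 2
    + q * `|eps k| * `|z k - zs| + (q + 2 * q ^+ 2 / kap) * `|eps k| ^+ 2).
  apply: (@cvg_dist_le _ _ _ _ _ g) => [k|].
    rewrite subr0 ger0_norm ?sqr_ge0// /g ler_pdivlMl//.
    by have := inexact k zs zsP; lra.
  have -> : 0 = kap^-1 * (l ^+ 2 - l ^+ 2 + q * 0 * l
      + (q + 2 * q ^+ 2 / kap) * 0 ^+ 2) by ring.
  have zl' : `|z k.+1 - zs| @[k --> \oo] --> l.
    by have := zl; rewrite -(cvg_shiftS (fun k => `|z k - zs|)).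
  apply: cvgMl_tmp; apply: cvgD.
    apply: cvgD; first by apply: cvgB; rewrite expr2; apply: cvgM.
    by apply: cvgM => //; apply: cvgMl_tmp.
  by apply: cvgMl_tmp; rewrite expr2; apply: cvgM.
have pz0 : `|p k - z k| @[k --> \oo] --> (0 : R).
  apply: (@cvg_dist_le _ _ _ _ _ (fun k => `|d k| + `|eps k|)) => [k|].
    rewrite subr0 normr_id /p distrC opprB addrA addrAC.
    by rewrite (le_trans (ler_normD _ _)).
  by rewrite -[0]addr0; apply: cvgD.
(* Without errors [p k = zt k], and [2 * t k >= c / L^2] scales the strong monotonicity term. *)
have exact_step : (forall k, eps k = 0) -> forall k zs,
    zer (op_add A (op_of B)) zs -> `|z k.+1 - zs| ^+ 2 <= `|z k - zs| ^+ 2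
    - 3 / 2 * (kap * `|d k| ^+ 2)
    - c / L ^+ 2 * ((gammaA + gammaB) * `|zt k - zs| ^+ 2).
  move=> e0 k zs zsP; apply: le_trans (dist k zs) _; rewrite lerD2l lerN2.
  have := inner k zs zsP; rewrite /p e0 normr0 mulr0 !mul0r !subr0.
  have [ct _ _ _] := step k; apply: ler_pM.
  - by rewrite divr_ge0 ?exprn_ge0// ltW.
  - by rewrite mulr_ge0 ?addr_ge0 ?exprn_ge0.
  - have -> : c / L ^+ 2 = 2 * (c / (2 * L ^+ 2)) by field; rewrite gt_eqF.
    by rewrite ler_pM2l.

(* Boundedness, weak convergence and strict decrease *)
split.
- by move=> zs zsP; apply: cvg_seq_bounded; exact: fejer.
- apply: (opial ip_norm zer_neq0 fejer) => F x FU oF zx.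
  have FP : ProperFilter F by exact: ultra_proper.
  have cvgF (u : nat -> R) (l : R) : u @ \oo --> l -> u @ F --> l.
    exact: (cvg_trans (cvg_app _ oF)).
  have [zs zsP] := zer_neq0.
  have [Kp pK] : exists Kp, forall k, `|p k| <= Kp.
    have [K1 zK] := cvgn_bounded (fejer zs zsP).
    have [K2 pzK] := cvgn_bounded (cvgP _ pz0).
    exists (K2 + K1 + `|zs|) => k; move: (zK k) (pzK k); rewrite !normr_id.
    have := ler_distD (z k) (p k) zs.
    have : `|p k| <= `|p k - zs| + `|zs|.
      by rewrite -[X in `|X| <= _](subrK zs) ler_normD.
    lra.
  have px h : ip (p k) h @[k --> F] --> ip x h.
    have -> : (fun k => ip (p k) h) = (fun k => ip (z k) h + ip (p k - z k) h).
      by apply/funext => k; rewrite -ipDl addrC subrK.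
    rewrite -[ip x h]addr0 -[X in _ --> _ + X](ip0l ip h); apply: cvgD => //.
    apply: (cvg_ipl ip_norm); under eq_fun do rewrite subr0.
    exact: cvgF.
  pose w k := M k (z k - p k) - (B (z k) - B (p k)).
  apply: (weak_limit_zer ip_norm pK px (w := w) A_max beta_gt0 B_coco zsP).
    move=> k; have -> : w k - B (p k) = M k (z k - p k) - B (z k).
      rewrite /w; move: (M k _) (B (z k)) (B (p k)) => a b b'.
      by rewrite opprB addrA addrAC addrK.
    exact: Ap.
  apply: cvgF.
  apply: (@cvg_dist_le _ _ _ _ _ (fun k => L * `|p k - z k|)) => [k|].
    by rewrite subr0 normr_id (distrC (p k));
      exact: (forward_norm_le ip_norm beta_gt0 B_coco (MC k)).
  by rewrite -(mulr0 L); apply: cvgMl_tmp.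
(* Strictness comes from [d k != 0]. *)
- move=> e0 zs zsP; apply/decreasing_seqP => k.
  rewrite -(@ltr_pXn2r _ 2)// ?nnegrE//.
  apply: le_lt_trans (exact_step e0 k zs zsP) _.
  have : 0 < kap * `|d k| ^+ 2 by rewrite mulr_gt0// exprn_gt0// normr_gt0.
  have : 0 <= c / L ^+ 2 * ((gammaA + gammaB) * `|zt k - zs| ^+ 2).
    by rewrite !mulr_ge0 ?invr_ge0 ?addr_ge0 ?exprn_ge0// ltW.
  lra.

(* Linear rate *)
move=> e0 gamma0.
have g0 : 0 < gammaA + gammaB by case: gamma0 => ?; lra.
(* The descent is at least [eta (|d k|^2 + |zt k - zs|^2)], hence at least [eta / 2 * |z k - zs|^2]
   by [Dd]; the cap [1 / 2] in [xi] keeps [1 - xi] positive. *)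
pose eta := Num.min kap (c / L ^+ 2 * (gammaA + gammaB)).
have eta0 : 0 < eta by rewrite lt_min kap0 mulr_gt0// divr_gt0// exprn_gt0.
pose xi := Num.min (1 / 2) (eta / 2).
have xi0 : 0 < xi by rewrite lt_min !divr_gt0.
have xi1 : xi <= 1 / 2 by rewrite ge_min lexx.
exists xi; first by rewrite xi0/=; lra.
move=> zs zsP; elim=> [|k IH]; first by rewrite expr0 mul1r.
rewrite (exprS (1 - xi)) -mulrA.
apply: (@le_trans _ _ ((1 - xi) * `|z k - zs| ^+ 2)); last first.
  by rewrite ler_wpM2l//; lra.
apply: le_trans (exact_step e0 k zs zsP) _.
have Dd : `|z k - zs| ^+ 2 <= 2 * (`|d k| ^+ 2 + `|zt k - zs| ^+ 2).
  have : `|z k - zs| <= `|d k| + `|zt k - zs|.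
    by rewrite (le_trans _ (ler_normD _ _))// addrA subrK.
  rewrite -(@ler_pXn2r _ 2)// ?nnegrE ?addr_ge0//.
  by have := sqr_ge0 (`|d k| - `|zt k - zs|); lra.
have e1 : eta * `|d k| ^+ 2 <= kap * `|d k| ^+ 2.
  by rewrite ler_wpM2r ?exprn_ge0// ge_min lexx.
have e2 : eta * `|zt k - zs| ^+ 2 <=
    c / L ^+ 2 * ((gammaA + gammaB) * `|zt k - zs| ^+ 2).
  by rewrite mulrA ler_wpM2r ?exprn_ge0// ge_min lexx orbT.
have e3 : xi * `|z k - zs| ^+ 2 <= eta / 2 * `|z k - zs| ^+ 2.
  by rewrite ler_wpM2r ?exprn_ge0// ge_min lexx orbT.
have := ler_wpM2l (ltW eta0) Dd.
have : 0 <= kap * `|d k| ^+ 2 by rewrite mulr_ge0 ?exprn_ge0// ltW.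
lra.
Qed.
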